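(* Let $\varphi:\mathbb{R}^n\to\mathbb{R}$ be of class $\mathcal{C}^{1,1}$ and let $x^0\in\mathbb{R}^n$ be such that $\partial^2\varphi(x)$ is positive-definite (i.e. $\langle z,u\rangle>0$ for all $u\ne0$, $z\in\partial^2\varphi(x)(u)$) for every $x$ in $\Omega:=\{x\mid\varphi(x)\le\varphi(x^0)\}$. Let $\{x^k\}$ be a sequence generated by the Generalized Damped Newton Algorithm (with $\sigma\in(0,\tfrac12)$, $\beta\in(0,1)$) from $x^0$, and suppose that $\{x^k\}$ converges to some $\bar x$ with $x^k\neq\bar x$ for all $k$. Then: (i) $\{\varphi(x^k)\}$ converges to $\varphi(\bar x)$ at least Q-linearly, i.e. there are $\mu\in(0,1)$ and $k_0$ with $\varphi(x^{k+1})-\varphi(\bar x)\le\mu(\varphi(x^k)-\varphi(\bar x))$ for $k\ge k_0$; (ii) $\{x^k\}$ converges to $\bar x$ and $\{\|\nabla\varphi(x^k)\|\}$ converges to $0$ at least R-linearly, i.e. there are $c>0$, $\lambda\in(0,1)$, $k_0$ with $\|x^k-\bar x\|\le c\lambda^k$ and $\|\nabla\varphi(x^k)\|\le c\lambda^k$ for all $k\ge k_0$.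
   Context: A function $\varphi:\mathbb{R}^n\to\mathbb{R}$ is of class $\mathcal{C}^{1,1}$ if it is continuously differentiable and $\nabla\varphi$ is Lipschitz continuous around every point. Regular normal cone: $\widehat N_\Omega(\bar z):=\{v\mid \limsup_{z\to\bar z,\,z\in\Omega}\langle v,z-\bar z\rangle/\|z-\bar z\|\le 0\}$; limiting normal cone $N_\Omega(\bar z)$: all $v$ with $z_k\to\bar z$, $z_k\in\Omega$, $v_k\to v$, $v_k\in\widehat N_\Omega(z_k)$. Coderivative of $F:\mathbb{R}^n\rightrightarrows\mathbb{R}^m$: $D^*F(\bar x,\bar y)(v):=\{u\mid (u,-v)\in N_{\operatorname{gph}F}(\bar x,\bar y)\}$. For $\mathcal{C}^{1,1}$ $\varphi$: $\partial^2\varphi(x)(u):=D^*(\nabla\varphi)(x,\nabla\varphi(x))(u)$. Generalized Damped Newton Algorithm: given $\sigma\in(0,\tfrac12)$, $\beta\in(0,1)$ and $x^0$, set $k=0$. If $\nabla\varphi(x^k)=0$ stop. Otherwise choose $d^k$ with $-\nabla\varphi(x^k)\in\partial^2\varphi(x^k)(d^k)$; set $\tau_k=1$ and, while $\varphi(x^k+\tau_kd^k)>\varphi(x^k)+\sigma\tau_k\langle\nabla\varphi(x^k),d^k\rangle$, replace $\tau_k$ by $\beta\tau_k$; set $x^{k+1}:=x^k+\tau_kd^k$, increase $k$ by 1 and repeat. *)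

(* Defs.v *)
From mathcomp Require Import all_boot all_order all_algebra.
From mathcomp Require Import reals.
Set Implicit Arguments. Unset Strict Implicit. Unset Printing Implicit Defensive.
Import Order.TTheory GRing.Theory Num.Theory.
Local Open Scope ring_scope.

Section Defs.
Variables (R : realType) (n : nat).

Definition vec := 'rV[R]_n.

Definition dot (u v : vec) : R := \sum_(i < n) u ord0 i * v ord0 i.
Definition enorm (u : vec) : R := Num.sqrt (dot u u).

Definition pdot (p q : vec * vec) : R := dot p.1 q.1 + dot p.2 q.2.
Definition pnorm (p : vec * vec) : R := Num.sqrt (pdot p p).
Definition psub (p q : vec * vec) : vec * vec := (p.1 - q.1, p.2 - q.2).

Definition is_gradient (phi : vec -> R) (g : vec -> vec) : Prop :=
  forall x : vec, forall eps : R, 0 < eps -> exists2 delta : R, 0 < delta &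
    forall y : vec, enorm (y - x) < delta ->
      `|phi y - phi x - dot (g x) (y - x)| <= eps * enorm (y - x).

Definition locally_lipschitz (g : vec -> vec) : Prop :=
  forall x : vec, exists L : R, exists2 delta : R, 0 < delta &
    forall y z : vec, enorm (y - x) < delta -> enorm (z - x) < delta ->
      enorm (g y - g z) <= L * enorm (y - z).

(* phi is C^{1,1} with gradient g (continuity of g follows from the local
   Lipschitz property) *)
Definition C11 (phi : vec -> R) (g : vec -> vec) : Prop :=
  is_gradient phi g /\ locally_lipschitz g.

(* regular normal cone to Omega at zbar (limsup <= 0, unfolded) *)
Definition regular_normal (Omega : vec * vec -> Prop) (zbar v : vec * vec)
  : Prop :=
  forall eps : R, 0 < eps -> exists2 delta : R, 0 < delta &
    forall z, Omega z -> pnorm (psub z zbar) < delta ->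
      pdot v (psub z zbar) <= eps * pnorm (psub z zbar).

Definition limiting_normal (Omega : vec * vec -> Prop) (zbar v : vec * vec)
  : Prop :=
  exists (z w : nat -> vec * vec),
    (forall k, Omega (z k)) /\
    (forall eps : R, 0 < eps -> exists N : nat, forall k, (N <= k)%N ->
       pnorm (psub (z k) zbar) < eps /\ pnorm (psub (w k) v) < eps) /\
    (forall k, regular_normal Omega (z k) (w k)).

Definition graph (g : vec -> vec) : vec * vec -> Prop :=
  fun p => p.2 = g p.1.

(* coderivative of the single-valued map g at (xbar, ybar): u \in D^*g(xbar,ybar)(v) *)
Definition coderiv (g : vec -> vec) (xbar ybar v u : vec) : Prop :=
  limiting_normal (graph g) (xbar, ybar) (u, - v).

(* second-order subdifferential: z \in \partial^2 phi(x)(u), g = grad phi *)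
Definition hess2 (g : vec -> vec) (x u z : vec) : Prop :=
  coderiv g x (g x) u z.

Definition posdef_hess2 (g : vec -> vec) (x : vec) : Prop :=
  forall u z : vec, u != 0 -> hess2 g x u z -> 0 < dot z u.

Definition armijo (phi : vec -> R) (g : vec -> vec) (sigma : R)
  (x d : vec) (tau : R) : Prop :=
  phi (x + tau *: d) <= phi x + sigma * tau * dot (g x) d.

(* xs is an (infinite) sequence generated by the Generalized Damped Newton
   Algorithm from x0: it never stops (nonzero gradient), each direction
   satisfies -grad phi(x^k) \in \partial^2 phi(x^k)(d^k), and tau_k = beta^m with
   m the first backtracking index satisfying the Armijo condition. *)
Definition GDNA_sequence (phi : vec -> R) (g : vec -> vec) (sigma beta : R)
  (x0 : vec) (xs : nat -> vec) : Prop :=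
  xs 0%N = x0 /\
  forall k : nat, g (xs k) != 0 /\
    exists d : vec, hess2 g (xs k) d (- g (xs k)) /\
      exists m : nat,
        armijo phi g sigma (xs k) d (beta ^+ m) /\
        (forall j : nat, (j < m)%N -> ~ armijo phi g sigma (xs k) d (beta ^+ j)) /\
        xs k.+1 = xs k + beta ^+ m *: d.

End Defs.

(* Main.v *)
Require Import Defs.
From mathcomp Require Import all_boot all_order all_algebra.
From mathcomp Require Import reals.
From mathcomp Require Import all_classical topology normedtype sequences derive.
From mathcomp Require Import ring lra.
Set Implicit Arguments. Unset Strict Implicit. Unset Printing Implicit Defensive.
Import Order.TTheory GRing.Theory Num.Theory numFieldNormedType.Exports.
Local Open Scope ring_scope.
Local Open Scope classical_set_scope.

(* The values phi(x^k) decrease to phi(xbar), so xbar lies in the level set and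
   the second-order subdifferential is positive-definite at xbar.  By
   compactness, regular normals (xi, -v) to the graph of g = grad phi near xbar
   satisfy <xi, v> >= kappa |v|^2 and |xi| <= L |v|.  A fuzzy mean value argument
   turns this into strong monotonicity of g near xbar: if <g b - g a, v> < m <
   kappa |v|^2 with v = b - a, a minimiser (t, x) of
     <v, g x> - m t + k/2 |x - a - t v|^2,  0 <= t <= 1,
   for k large has t > 0, and xi = - k (x - a - t v) gives a regular normal
   (xi, -v) with <xi, v> <= m.  Strong monotonicity yields
   phi(x^k) - phi(xbar) <= |g(x^k)|^2 / kappa, whereas the backtracking steps are
   bounded below, so each iteration decreases phi by at least c |g(x^k)|^2. *)

(** * Euclidean inner product and norm on row vectors *)

Section EuclideanNorm.
Variables (R : realType) (n : nat).
Implicit Types (u v w : vec R n) (a : R).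

Lemma dotC u v : dot u v = dot v u.
Proof. by apply: eq_bigr => i _; rewrite mulrC. Qed.

Lemma dotDl u v w : dot (u + v) w = dot u w + dot v w.
Proof. by rewrite /dot -big_split; apply: eq_bigr => i _; rewrite mxE mulrDl. Qed.

Lemma dotZl a u v : dot (a *: u) v = a * dot u v.
Proof. by rewrite /dot mulr_sumr; apply: eq_bigr => i _; rewrite mxE mulrA. Qed.

Lemma dotNl u v : dot (- u) v = - dot u v.
Proof. by rewrite -scaleN1r dotZl mulN1r. Qed.

Lemma dotDr u v w : dot u (v + w) = dot u v + dot u w.
Proof. by rewrite dotC dotDl !(dotC _ u). Qed.

Lemma dotZr a u v : dot u (a *: v) = a * dot u v.
Proof. by rewrite dotC dotZl dotC. Qed.

Lemma dotNr u v : dot u (- v) = - dot u v.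
Proof. by rewrite dotC dotNl dotC. Qed.

Definition dotE := (dotDl, dotDr, dotNl, dotNr, dotZl, dotZr).

Lemma dot0l v : dot 0 v = 0.
Proof. by rewrite -(scale0r 0) dotZl mul0r. Qed.

Lemma dot0r v : dot v 0 = 0.
Proof. by rewrite dotC dot0l. Qed.

Lemma dot_ge0 u : 0 <= dot u u.
Proof. by apply: sumr_ge0 => i _; rewrite -expr2 sqr_ge0. Qed.

Lemma enorm_ge0 u : 0 <= enorm u.
Proof. exact: sqrtr_ge0. Qed.

Lemma sqr_enorm u : enorm u ^+ 2 = dot u u.
Proof. by rewrite sqr_sqrtr ?dot_ge0. Qed.

Lemma enorm0 : enorm (0 : vec R n) = 0.
Proof. by rewrite /enorm dot0l sqrtr0. Qed.

Lemma coord_le_enorm u i : `|u ord0 i| <= enorm u.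
Proof.
rewrite -sqrtr_sqr ler_wsqrtr // /dot (bigD1 i) //= -expr2 lerDl.
by apply: sumr_ge0 => j _; rewrite -expr2 sqr_ge0.
Qed.

Lemma enorm_eq0 u : (enorm u == 0) = (u == 0).
Proof.
apply/idP/idP => [/eqP u0|/eqP->]; last by rewrite enorm0.
apply/eqP/rowP => i; rewrite mxE; apply/eqP; rewrite -normr_le0 -u0.
exact: coord_le_enorm.
Qed.

Lemma enorm_gt0 u : (0 < enorm u) = (u != 0).
Proof. by rewrite lt_def enorm_ge0 andbT enorm_eq0. Qed.

Lemma enormZ a u : enorm (a *: u) = `|a| * enorm u.
Proof. by rewrite /enorm dotZl dotZr mulrA sqrtrM -?expr2 ?sqr_ge0 // sqrtr_sqr. Qed.

Lemma enormN u : enorm (- u) = enorm u.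
Proof. by rewrite -scaleN1r enormZ normrN1 mul1r. Qed.

Lemma enorm_distC u v : enorm (u - v) = enorm (v - u).
Proof. by rewrite -enormN opprB. Qed.

(** Cauchy-Schwarz: the square of [enorm v *: u - enorm u *: v] is nonnegative and expands to
    [2 |u||v| (|u||v| - <u, v>)]; zero vectors are split off so that [|u||v|] can be cancelled. *)
Lemma dot_le_enorm u v : dot u v <= enorm u * enorm v.
Proof.
have [->|u0] := eqVneq u 0; first by rewrite dot0l enorm0 mul0r.
have [->|v0] := eqVneq v 0; first by rewrite dot0r enorm0 mulr0.
have := dot_ge0 (enorm v *: u - enorm u *: v).
move: u0 v0; rewrite -!enorm_gt0 => u0 v0.
have := mulr_gt0 u0 v0.
rewrite !dotE (dotC v u) -!sqr_enorm => p h.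
by rewrite -(ler_pM2l p) -subr_ge0; nra.
Qed.

Lemma normr_dot_le u v : `|dot u v| <= enorm u * enorm v.
Proof.
rewrite ler_norml dot_le_enorm andbT lerNl -dotNl -(enormN u).
exact: dot_le_enorm.
Qed.

Lemma enorm_triangle u v : enorm (u + v) <= enorm u + enorm v.
Proof.
rewrite -(@ler_pXn2r _ 2) ?nnegrE ?addr_ge0 ?enorm_ge0 //.
rewrite sqrrD !sqr_enorm !dotE (dotC v u).
have := dot_le_enorm u v; lra.
Qed.

Lemma enorm_triangleB w u v : enorm (u - v) <= enorm (u - w) + enorm (w - v).
Proof. by have := enorm_triangle (u - w) (w - v); rewrite addrA subrK. Qed.

Lemma enorm_le_sum u : enorm u <= \sum_(i < n) `|u ord0 i|.
Proof.
rewrite -(@ler_pXn2r _ 2) ?nnegrE ?enorm_ge0 ?sumr_ge0 // sqr_enorm expr2.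
rewrite mulr_suml; apply: ler_sum => i _.
rewrite -expr2 -real_normK ?num_real // expr2 ler_wpM2l //.
by rewrite (bigD1 i) //= lerDl sumr_ge0.
Qed.

Lemma pnorm_le (p : vec R n * vec R n) : pnorm p <= enorm p.1 + enorm p.2.
Proof.
rewrite -(@ler_pXn2r _ 2) ?nnegrE ?sqrtr_ge0 ?addr_ge0 ?enorm_ge0 //.
rewrite sqr_sqrtr ?addr_ge0 ?dot_ge0 // sqrrD !sqr_enorm /pdot.
have := mulr_ge0 (enorm_ge0 p.1) (enorm_ge0 p.2); lra.
Qed.

Lemma enorm_fst_le (p : vec R n * vec R n) : enorm p.1 <= pnorm p.
Proof. by rewrite ler_wsqrtr // lerDl dot_ge0. Qed.

Lemma enorm_snd_le (p : vec R n * vec R n) : enorm p.2 <= pnorm p.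
Proof. by rewrite ler_wsqrtr // lerDr dot_ge0. Qed.

(* The library topology on row vectors is that of the sup norm. *)
Lemma nbhs_enormP (x : 'rV[R]_n) (A : set 'rV[R]_n) :
  nbhs x A <-> exists2 e, 0 < e & forall y, enorm (y - x : vec R n) < e -> A y.
Proof.
split=> [/nbhs_ballP [e e0 sA]|[e e0 sA]].
  exists e => // y yx; apply: sA; split=> // i j.
  rewrite /ball /= (ord1 i) distrC (le_lt_trans _ yx) //.
  by have := coord_le_enorm (y - x : vec R n) j; rewrite !mxE.
(* Dividing by [n.+1] rather than [n] keeps the sum of [n] terms strictly below [e], also for
   [n = 0]. *)
apply/nbhs_ballP; exists (e / n.+1%:R); first by rewrite /= divr_gt0.
move=> y [_ xy]; apply: sA; apply: le_lt_trans (enorm_le_sum _) _.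
apply: (@le_lt_trans _ _ (\sum_(i < n) e / n.+1%:R)).
  apply: ler_sum => i _; rewrite !mxE distrC; apply: ltW; exact: xy.
rewrite sumr_const card_ord -[X in X < _]mulr_natr mulrAC ltr_pdivrMr // ltr_pM2l //.
by rewrite ltr_nat.
Qed.

End EuclideanNorm.

(** * Sequences, compactness and first-order calculus *)

Section Limits.
Variables (R : realType) (n : nat).
Implicit Types (u v w x y : vec R n).

Lemma cvg_enormP (u : nat -> vec R n) x :
  (u k @[k --> \oo] --> x) <->
  (forall eps : R, 0 < eps -> exists N : nat, forall k, (N <= k)%N ->
     enorm (u k - x) < eps).
Proof.
split=> [ux e e0|ux A].
  have /ux [N _ hN] : nbhs x [set y : 'rV[R]_n | enorm (y - x : vec R n) < e].
    by apply/nbhs_enormP; exists e.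
  by exists N => k Nk; exact: hN.
move/nbhs_enormP => [e e0 sA]; have [N hN] := ux e e0.
by exists N => // k /hN; exact: sA.
Qed.

Lemma continuous_enormP (m : nat) (f : vec R n -> vec R m) :
  continuous f <->
  (forall x (eps : R), 0 < eps -> exists2 delta : R, 0 < delta &
     forall y, enorm (y - x) < delta -> enorm (f y - f x) < eps).
Proof.
split=> [cf x e e0|cf x A /nbhs_enormP[e e0 sA]].
  have /cf : nbhs (f x) [set z : 'rV[R]_m | enorm (z - f x : vec R m) < e].
    by apply/nbhs_enormP; exists e.
  by move/nbhs_enormP.
apply/nbhs_enormP; have [d d0 hd] := cf x e e0; exists d => // y /hd.
exact: sA.
Qed.

Lemma cvg_dot (T : Type) (F : set_system T) (FF : Filter F)
    (u v : T -> vec R n) x y :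
  u t @[t --> F] --> x -> v t @[t --> F] --> y ->
  dot (u t) (v t) @[t --> F] --> dot x y.
Proof.
move=> ux vy; rewrite /dot.
apply: cvg_big => [|i _]; first exact: add_continuous.
apply: cvgM.
  exact: (cvg_comp _ _ ux (@coord_continuous R 1 n ord0 i x)).
exact: (cvg_comp _ _ vy (@coord_continuous R 1 n ord0 i y)).
Qed.

(** The sequence stays in the compact box [[-M, M]^n], so its tail filter has a cluster point. *)
Lemma bounded_cluster (u : nat -> vec R n) (M : R) :
  (forall k, enorm (u k) <= M) ->
  exists x, forall (e : R) (N : nat), 0 < e ->
    exists2 k, (N <= k)%N & enorm (u k - x) < e.
Proof.
move=> uM.
have /(_ (u k @[k --> \oo])) := @rV_compact R n _ (fun=> @segment_compact R (- M) M).
case.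
  exists 0%N => // k _ i /=; rewrite in_itv /= -ler_norml.
  exact: le_trans (coord_le_enorm _ _) (uM k).
move=> x [_ clx]; exists x => e N e0.
have [||z [[k Nk <-]]] := clx [set u k | k in [set k | (N <= k)%N]]
    [set y : 'rV[R]_n | enorm (y - x : vec R n) < e].
- by exists N => // k Nk; exists k.
- by apply/nbhs_enormP; exists e.
by move=> /= kx; exists k.
Qed.

(** The condition [k <= f k] takes the place of strict monotonicity: it preserves limits and is
    stable under composition. *)
Lemma bounded_subseq (u : nat -> vec R n) (M : R) :
  (forall k, enorm (u k) <= M) ->
  exists x (f : nat -> nat), (forall k, (k <= f k)%N) /\
    u (f k) @[k --> \oo] --> x.
Proof.
move=> /bounded_cluster [x hx]; exists x.
have /choice [f hf] : forall N : nat, exists k,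
    (N <= k)%N /\ enorm (u k - x) < N.+1%:R^-1.
  by move=> N; have [|k] := hx N.+1%:R^-1 N; [rewrite invr_gt0|exists k].
exists f; split=> [k|]; first by have [] := hf k.
apply/cvg_enormP => e e0; exists (Num.bound e^-1) => k Nk.
have [_ /lt_le_trans ->//] := hf k.
rewrite -[leRHS]invrK lef_pV2 ?posrE ?invr_gt0 //.
apply/ltW/(lt_le_trans (archi_boundP _)); first by rewrite invr_ge0 ltW.
by rewrite ler_nat (leq_trans Nk).
Qed.

Lemma cvg_subseq (T : topologicalType) (u : nat -> T) (x : T) (f : nat -> nat) :
  (forall k, (k <= f k)%N) -> u k @[k --> \oo] --> x ->
  u (f k) @[k --> \oo] --> x.
Proof.
move=> fk ux A /ux [N _ hN]; exists N => // k /= Nk; apply: hN => /=.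
exact: leq_trans Nk (fk k).
Qed.

Lemma gradient_continuous phi g : is_gradient phi g -> continuous (phi : vec R n -> R).
Proof.
move=> dphi x; apply/(@cvgrPdist_lt _ _ _ _ (nbhs_filter (x : 'rV[R]_n))) => e e0.
have [d d0 hd] := dphi x 1 ltr01.
pose c := enorm (g x) + 1; have c0 : 0 < c by rewrite ltr_wpDl ?enorm_ge0.
apply/nbhs_enormP; exists (Num.min d (e / c)); first by rewrite lt_min d0 divr_gt0.
move=> y /=; rewrite lt_min => /andP[/hd]; rewrite ltr_pdivlMr // => h1 h2.
rewrite distrC; apply: le_lt_trans h2.
have := normr_dot_le (g x) (y - x); move: h1; rewrite /c !ler_norml; lra.
Qed.

Lemma locally_lipschitz_continuous (g : vec R n -> vec R n) :
  locally_lipschitz g -> continuous g.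
Proof.
move=> lg; apply/continuous_enormP => x e e0; have [L [d d0 hd]] := lg x.
(* [L] has no prescribed sign; [c] is positive and dominates it. *)
pose c := `|L| + 1; have c0 : 0 < c by rewrite ltr_wpDl.
exists (Num.min d (e / c)); first by rewrite lt_min d0 divr_gt0.
move=> y; rewrite lt_min => /andP[yd]; rewrite ltr_pdivlMr // => h2.
have /(hd _ _ yd) : enorm (x - x) < d by rewrite subrr enorm0.
move=> /le_lt_trans-> //; apply: le_lt_trans h2; rewrite mulrC /c.
by rewrite ler_wpM2l ?enorm_ge0 // (le_trans (ler_norm L)) // lerDl.
Qed.

(** The one-variable mean value theorem is applied to [th] along the segment; most of the work
    derives [is_derive] from the gradient expansion. *)
Lemma gradient_MVT phi g (x v : vec R n) : is_gradient phi g ->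
  exists2 t : R, 0 <= t <= 1 & phi (x + v) - phi x = dot (g (x + t *: v)) v.
Proof.
move=> dphi; pose th t : R := phi (x + t *: v).
pose dth t := dot (g (x + t *: v)) v.
have th_derive (t : R) : is_derive t 1 th (dth t).
  suff H : h^-1 *: (th (h *: 1 + t) - th t) @[h --> 0^'] --> dth t.
    by apply: DeriveDef; [apply/cvg_ex; exists (dth t)|exact: (cvg_lim _ H)].
  apply/cvgrPdist_le => e e0.
  pose c := enorm v + 1; have c0 : 0 < c by rewrite ltr_wpDl ?enorm_ge0.
  have ec0 : 0 < e / c by rewrite divr_gt0.
  have [d d0 hd] := dphi (x + t *: v) (e / c) ec0.
  apply/nbhs_ballP; exists (d / c); first by rewrite /= divr_gt0.
  move=> h; rewrite /ball /= sub0r normrN => hdc h0.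
  have hc : `|h| * enorm v <= `|h| * c by rewrite ler_wpM2l // lerDl.
  have := hd (x + t *: v + h *: v).
  have -> : x + t *: v + h *: v = x + (h + t) *: v.
    by apply/rowP => i; rewrite !mxE; ring.
  have -> : x + (h + t) *: v - (x + t *: v) = h *: v.
    by apply/rowP => i; rewrite !mxE; ring.
  rewrite enormZ.
  move: hdc; rewrite ltr_pdivlMr // => hdc /(_ (le_lt_trans hc hdc)).
  rewrite dotZr -/(dth t) -/(th _) -/(th t) => H.
  have -> : dth t - h^-1 *: (th (h *: 1 + t) - th t) =
      - h^-1 * (th (h + t) - th t - h * dth t).
    rewrite /GRing.scale /= mulr1; field.
    exact: h0.
  rewrite normrM normrN normfV ler_pdivrMl ?normr_gt0 //.
  apply: le_trans H _.
  have -> : `|h| * e = e / c * (`|h| * c) by field; rewrite gt_eqF.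
  by rewrite ler_pM2l.
have [|t] := @MVT_segment R th dth 0 1 ler01 (fun t _ => th_derive t).
  apply: continuous_subspaceT => t.
  by apply/differentiable_continuous/derivable1_diffP.
rewrite in_itv /= subr0 mulr1 /th scale1r scale0r addr0 => t01 E.
by exists t.
Qed.

End Limits.

(** * Normals to graphs and uniform positive-definiteness *)

Section Normals.
Variables (R : realType) (n : nat).
Implicit Types (c u v w x y xi : vec R n) (g : vec R n -> vec R n).

(** Tested at the graph point over [c + t *: xi], the normal inequality reads
    [t |xi|^2 - <v, g y - g c> <= o(t)], and the Lipschitz bound turns this into
    [|xi| <= L |v| + e]. *)
Lemma regular_normal_graph_le g c xi v (L d : R) : 0 <= L -> 0 < d ->
  (forall y, enorm (y - c) < d -> enorm (g y - g c) <= L * enorm (y - c)) ->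
  regular_normal (graph g) (c, g c) (xi, - v) ->
  enorm xi <= L * enorm v.
Proof.
move=> L0 d0 lip nrm; have [->|xi0] := eqVneq xi 0.
  by rewrite enorm0 mulr_ge0 ?enorm_ge0.
set a := enorm xi; have a0 : 0 < a by rewrite enorm_gt0.
apply/ler_addgt0Pr => e e0.
have L1 : 0 < 1 + L by rewrite ltr_wpDr.
have [d' d'0 hd'] := nrm (e / (1 + L)) (divr_gt0 e0 L1).
(* The displacement [t * a = b / 2] stays below [d], and the graph increment, of norm at most
   [t * a * (1 + L)], stays below [d']. *)
pose b := Num.min d (d' / (1 + L)).
have b0 : 0 < b by rewrite lt_min d0 divr_gt0.
pose t := b / 2 / a.
have t0 : 0 < t by rewrite !divr_gt0.
have ta : t * a < b by rewrite /t divfK ?gt_eqF //; lra.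
have tad : t * a < d by apply: lt_le_trans ta _; rewrite ge_min lexx.
have tad' : t * a * (1 + L) < d'.
  by rewrite -ltr_pdivlMr //; apply: lt_le_trans ta _; rewrite ge_min lexx orbT.
pose y := c + t *: xi.
have yc : y - c = t *: xi by rewrite /y addrAC subrr add0r.
have nyc : enorm (y - c) = t * a by rewrite yc enormZ gtr0_norm.
have lipy := lip y; rewrite nyc in lipy; have {}lipy := lipy tad.
have pn : pnorm (psub (y, g y) (c, g c)) <= t * a * (1 + L).
  by apply: le_trans (pnorm_le _) _; rewrite /= nyc; lra.
have := hd' (y, g y) (erefl _) (le_lt_trans pn tad').
rewrite /pdot /= yc dotNl dotZr -sqr_enorm -/a => H.
have H2 : e / (1 + L) * pnorm (psub (y, g y) (c, g c)) <= e * (t * a).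
  apply: (@le_trans _ _ (e / (1 + L) * (t * a * (1 + L)))).
    by rewrite ler_pM2l // divr_gt0.
  by rewrite le_eqVlt; apply/orP; left; apply/eqP; field; rewrite gt_eqF.
have H3 := dot_le_enorm v (g y - g c).
have H4 := ler_wpM2l (enorm_ge0 v) lipy.
have ta0 : 0 < t * a by rewrite mulr_gt0.
rewrite -(ler_pM2l ta0); lra.
Qed.

Lemma regular_normal_scale (Om : vec R n * vec R n -> Prop) z u v (a : R) :
  0 < a -> regular_normal Om z (u, v) -> regular_normal Om z (a *: u, a *: v).
Proof.
move=> a0 nrm e e0; have [d d0 hd] := nrm (e / a) (divr_gt0 e0 a0).
exists d => // y Oy yd; have := hd y Oy yd.
by rewrite /pdot /= !dotZl -mulrDr mulrAC ler_pdivlMr // mulrC.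
Qed.

(** Continuity of [g] makes the second component of the base points converge by itself, so only [c],
    [xi] and [v] are tracked, each by an ordinary limit; [v] absorbs the sign in the
    coderivative. *)
Lemma hess2P g x u z : continuous g ->
  hess2 g x u z <->
  exists c xi v : nat -> vec R n,
    [/\ c k @[k --> \oo] --> x, xi k @[k --> \oo] --> z,
        v k @[k --> \oo] --> u &
        forall k, regular_normal (graph g) (c k, g (c k)) (xi k, - v k)].
Proof.
move=> cg; split=> [[p [w [pg [cv nrm]]]]|[c [xi [v [cx xiz vu nrm]]]]].
  exists (fun k => (p k).1), (fun k => (w k).1), (fun k => - (w k).2); split.
  - apply/cvg_enormP => e /cv [N hN]; exists N => k /hN [h _].
    exact: le_lt_trans (enorm_fst_le _) h.
  - apply/cvg_enormP => e /cv [N hN]; exists N => k /hN [_ h].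
    exact: le_lt_trans (enorm_fst_le _) h.
  - apply/cvg_enormP => e /cv [N hN]; exists N => k /hN [_ h].
    rewrite -opprD enormN -[u]opprK; exact: le_lt_trans (enorm_snd_le _) h.
  - move=> k; have := nrm k; have := pg k; rewrite /graph opprK => <-.
    by case: (p k) (w k) => [? ?] [? ?].
exists (fun k => (c k, g (c k))), (fun k => (xi k, - v k)); split=> //; split=> //.
have gcx : g (c k) @[k --> \oo] --> g x := cvg_comp _ _ cx (cg x).
move=> e e0; have e20 : 0 < e / 2 by lra.
have [N1 h1] := (cvg_enormP _ _).1 cx _ e20.
have [N2 h2] := (cvg_enormP _ _).1 gcx _ e20.
have [N3 h3] := (cvg_enormP _ _).1 xiz _ e20.
have [N4 h4] := (cvg_enormP _ _).1 vu _ e20.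
exists (maxn (maxn N1 N2) (maxn N3 N4)) => k.
rewrite !geq_max => /andP[/andP[/h1 a1 /h2 a2] /andP[/h3 a3 /h4 a4]].
split; apply: le_lt_trans (pnorm_le _) _ => /=; first by lra.
by rewrite -opprD enormN; lra.
Qed.

(** Compactness upgrades positivity at one point to a bound on regular normals nearby. Otherwise
    unit [v k] and bounded [xi k], at points tending to [x] and with [<xi k, v k>] at most
    [harmonic k], would have a limit pair in [hess2 g x] with [|u| = 1] and [<z, u> <= 0]. *)
Lemma posdef_hess2_uniform g x : locally_lipschitz g -> posdef_hess2 g x ->
  exists kappa r : R, [/\ 0 < kappa, 0 < r & forall c xi v,
    enorm (c - x) < r -> regular_normal (graph g) (c, g c) (xi, - v) ->
    kappa * dot v v <= dot xi v].
Proof.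
move=> lg pd; have [L [d d0 lip]] := lg x.
have cg := locally_lipschitz_continuous lg.
apply: contrapT => no.
have /choice [q hq] : forall k : nat, exists q : vec R n * vec R n * vec R n,
    [/\ enorm (q.1.1 - x) < d * harmonic k, enorm q.2 = 1,
      dot q.1.2 q.2 <= harmonic k &
      regular_normal (graph g) (q.1.1, g q.1.1) (q.1.2, - q.2)].
  move=> k; apply: contrapT => noq; apply: no.
  have hk : 0 < (harmonic k : R) by rewrite harmonic_gt0.
  exists (harmonic k), (d * harmonic k); split=> //; first by rewrite mulr_gt0.
  move=> c xi v cx nrm; rewrite leNgt; apply/negP => lt; apply: noq.
  have v0 : 0 < enorm v.
    by rewrite enorm_gt0; apply/eqP => v0; move: lt; rewrite v0 !dot0r mulr0 ltxx.
  (* A violated bound forces [v] to be nonzero, and normals form a cone, so the pair can be divided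
     by [|v|]. *)
  exists (c, (enorm v)^-1 *: xi, (enorm v)^-1 *: v) => /=; split=> //.
  - by rewrite enormZ gtr0_norm ?invr_gt0 // mulVf // gt_eqF.
  - rewrite dotZl dotZr mulrA -invfM ler_pdivrMl ?mulr_gt0 //.
    by rewrite -expr2 sqr_enorm mulrC ltW.
  - by rewrite -scalerN; apply: regular_normal_scale; rewrite ?invr_gt0.
pose c k := (q k).1.1; pose xi k := (q k).1.2; pose v k := (q k).2.
have v1 k : enorm (v k) = 1 by have [] := hq k.
have lim0 (a : R) : a * harmonic k @[k --> \oo] --> 0.
  by rewrite -(mulr0 a); apply: cvgM; [exact: cvg_cst|exact: cvg_harmonic].
have cx : c k @[k --> \oo] --> x.
  apply/cvg_enormP => e e0.
  have /cvgrPdist_lt /(_ e e0) [N _ hN] := lim0 d.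
  exists N => k Nk; have [/lt_trans-> //] := hq k.
  have := hN k Nk; rewrite /= sub0r normrN; exact: le_lt_trans (ler_norm _).
have xiL k : enorm (xi k) <= `|L|.
  have [ckd _ _ nrm] := hq k.
  have cd : enorm (c k - x) < d.
    apply: lt_le_trans ckd _; rewrite ler_piMr ?(ltW d0) //.
    by rewrite invf_le1 // ler1n.
  rewrite -[leRHS]mulr1 -(v1 k).
  apply: (@regular_normal_graph_le g (c k) _ _ _ (d - enorm (c k - x))) => //.
    by rewrite subr_gt0.
  move=> y yc; have := lip y (c k) _ cd.
  have -> : enorm (y - x) < d.
    by apply: le_lt_trans (enorm_triangleB (c k) _ _) _; lra.
  move/(_ isT) => /le_trans-> //.
  by rewrite ler_wpM2r ?enorm_ge0 ?ler_norm.
(* Two successive extractions; the composite index [f1 (f2 k)] serves all three sequences. *)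
have [z [f1 [hf1 xiz]]] := bounded_subseq xiL.
have v1' k : enorm (v (f1 k)) <= 1 by rewrite v1.
have [u [f2 [hf2 vu]]] := bounded_subseq v1'.
have hf k : (k <= f1 (f2 k))%N := leq_trans (hf2 k) (hf1 _).
have {}xiz : xi (f1 (f2 k)) @[k --> \oo] --> z := cvg_subseq hf2 xiz.
have H : hess2 g x u z.
  apply/hess2P => //.
  exists (fun k => c (f1 (f2 k))), (fun k => xi (f1 (f2 k))), (fun k => v (f1 (f2 k))).
  split=> // [|k]; first exact: (cvg_subseq hf cx).
  by have [] := hq (f1 (f2 k)).
have uu : dot u u = 1.
  apply/eqP; rewrite eq_le; apply/andP; split.
    apply: (cvgr_to_le (cvg_dot _ vu vu)); apply: nearW => k.
    by rewrite -sqr_enorm v1 expr1n.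
  apply: (cvgr_to_ge (cvg_dot _ vu vu)); apply: nearW => k.
  by rewrite -sqr_enorm v1 expr1n.
have u0 : u != 0.
  by apply/eqP => u0; move: uu; rewrite u0 dot0l => /esym/eqP; rewrite oner_eq0.
have := pd u z u0 H; apply/negP; rewrite -leNgt.
apply: (ler_cvg_to (cvg_dot _ xiz vu) (cvg_subseq hf (lim0 1))).
apply: nearW => k; rewrite mul1r.
by have [] := hq (f1 (f2 k)).
Qed.

End Normals.

(** * Strong monotonicity by penalised minimisation *)

Section StrongMonotonicity.
Variables (R : realType) (n : nat).
Implicit Types (a b p u v x y : vec R n) (g : vec R n -> vec R n).

Lemma enorm_segment_lt x a v (t r : R) : 0 <= t <= 1 ->
  enorm (a - x) < r -> enorm (a + v - x) < r -> enorm (a + t *: v - x) < r.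
Proof.
move=> /andP[t0 t1] ar br.
have -> : a + t *: v - x = (1 - t) *: (a - x) + t *: (a + v - x).
  by apply/rowP => i; rewrite !mxE; ring.
apply: le_lt_trans (enorm_triangle _ _) _.
rewrite !enormZ !ger0_norm ?subr_ge0 //.
set A := enorm (a - x) in ar *; set B := enorm (a + v - x) in br *.
have mr : Num.max A B < r by rewrite gt_max ar.
have Am : A <= Num.max A B by rewrite le_max lexx.
have Bm : B <= Num.max A B by rewrite le_max lexx orbT.
apply: le_lt_trans mr; nra.
Qed.

Lemma enorm_dist_continuous x :
  continuous (fun y : 'rV[R]_n => enorm (y - x : vec R n)).
Proof.
move=> y; apply/(@cvgrPdist_lt _ _ _ _ (nbhs_filter (y : 'rV[R]_n))) => e e0.
apply/nbhs_enormP; exists e => // z zy.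
apply: le_lt_trans zy; rewrite ler_norml.
have := enorm_triangleB y z x; have := enorm_triangleB z y x.
rewrite (enorm_distC y z); lra.
Qed.

Lemma compact_enorm_ball x (r : R) :
  compact [set y : 'rV[R]_n | enorm (y - x : vec R n) <= r].
Proof.
pose S i := `[x ord0 i - r, x ord0 i + r].
apply: (@subclosed_compact _ _ [set y : 'rV[R]_n | forall i, S i (y ord0 i)]).
- apply: (@preimage_closed _ _ (fun y : 'rV[R]_n => enorm (y - x : vec R n))
            [set s | s <= r]); last exact: closed_le.
  by move=> y _; exact: enorm_dist_continuous.
- by apply: rV_compact => i; exact: segment_compact.
- move=> y yx i; have := le_trans (coord_le_enorm _ i) yx.
  by rewrite !mxE /S /= in_itv /= ler_norml; lra.
Qed.

(** Expanding [|y - p|^2] about [x] turns minimality into [- k <x - p, y - x> - <v, g y - g x> <=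
    k/2 |y - x|^2], whose right side is [o(|y - x|)]. *)
Lemma prox_regular_normal g v p x (k d : R) : 0 < k -> 0 < d ->
  (forall y, enorm (y - x) < d ->
     dot v (g x) + k / 2 * dot (x - p) (x - p) <=
     dot v (g y) + k / 2 * dot (y - p) (y - p)) ->
  regular_normal (graph g) (x, g x) (- k *: (x - p), - v).
Proof.
move=> k0 d0 xmin e e0; exists (Num.min d (e / k)).
  by rewrite lt_min d0 divr_gt0.
move=> [y w]; rewrite /graph /= => ->; rewrite lt_min => /andP[yd yek].
have le := enorm_fst_le (psub (y, g y) (x, g x)).
have {xmin} := xmin y (le_lt_trans le yd).
have -> : y - p = (x - p) + (y - x) by apply/rowP => i; rewrite !mxE; ring.
move: le yek; rewrite ltr_pdivlMr //= /pdot /= dotNl dotZl.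
move: (pnorm _) (x - p) => P u; have := sqr_enorm (y - x).
have := enorm_ge0 (y - x).
move: (y - x) => q; set N := enorm q => N0 NE NP Pk.
rewrite !(dotDl, dotDr) dotNr (dotC q u) -NE => H.
have kN : k * N <= e by apply: le_trans (ltW Pk); rewrite mulrC ler_pM2r.
have h1 := ler_wpM2r N0 kN; have h2 := ler_wpM2l (ltW e0) NP.
have h3 := mulr_ge0 (ltW k0) (sqr_ge0 N).
lra.
Qed.

(** The end points lie within [r] of [x], the minimisation runs over radius [2 * r], and the
    hypotheses hold up to [3 * r]; a minimiser within [r] of the segment is thus interior in the
    second variable. *)
Lemma strong_monotone g x (kappa L r : R) : continuous g -> 0 < r -> 0 <= L ->
  (forall y z, enorm (y - x) < 3 * r -> enorm (z - x) < 3 * r ->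
     enorm (g y - g z) <= L * enorm (y - z)) ->
  (forall c xi v, enorm (c - x) < 3 * r ->
     regular_normal (graph g) (c, g c) (xi, - v) ->
     kappa * dot v v <= dot xi v) ->
  forall a v, enorm (a - x) < r -> enorm (a + v - x) < r ->
    kappa * dot v v <= dot (g (a + v) - g a) v.
Proof.
move=> cg r0 L0 lip pos a v ar br; rewrite leNgt; apply/negP => Dlt.
set b := a + v in br Dlt; set D := dot (g b - g a) v in Dlt.
set Q := dot v v in Dlt; have Q0 : 0 <= Q := dot_ge0 v.
(* [m] is the midpoint of [D] and [kappa * Q], at distance [gap] from both. *)
pose m := (D + kappa * Q) / 2; pose gap := m - D.
have gap0 : 0 < gap by rewrite /gap /m; lra.
have mQ : m = kappa * Q - gap by rewrite /gap /m; lra.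
pose K := L * enorm v; have K0 : 0 <= K by rewrite mulr_ge0 ?enorm_ge0.
(* Large enough for [kgap], which rules out [t = 0], and for [kr], which keeps the minimiser within
   [r] of [p t]. *)
pose k := K ^+ 2 / gap + 2 * K / r + 1.
have kA : 0 <= K ^+ 2 / gap by rewrite divr_ge0 ?sqr_ge0 // ltW.
have kB : 0 <= 2 * K / r by rewrite divr_ge0 ?(ltW r0) // mulr_ge0.
have k0 : 0 < k by rewrite /k; lra.
have kgap : K ^+ 2 < k * gap.
  by rewrite -ltr_pdivrMr // /k; lra.
have kr : 2 * K < k * r by rewrite -ltr_pdivrMr // /k; lra.
pose p (t : R) := a + t *: v.
pose F (z : R * 'rV[R]_n) : R := dot v (g z.2) - m * z.1 +
  k / 2 * dot (z.2 - p z.1) (z.2 - p z.1).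
have cF : continuous F.
  move=> z.
  have c1 : y.1 @[y --> z] --> z.1 by exact: cvg_fst.
  have c2 : y.2 @[y --> z] --> z.2 by exact: cvg_snd.
  have c3 : y.2 - p y.1 @[y --> z] --> z.2 - p z.1.
    apply: cvgB => //; apply: cvgD; first exact: cvg_cst.
    exact: cvgZr_tmp.
  apply: cvgD; last by apply: cvgM; [exact: cvg_cst|exact: cvg_dot].
  apply: cvgB; last by apply: cvgM => //; exact: cvg_cst.
  apply: cvg_dot; first exact: cvg_cst.
  exact: (cvg_comp _ _ c2 (cg _)).
have pr t : 0 <= t <= 1 -> enorm (p t - x) < r.
  by move=> t01; exact: enorm_segment_lt.
have p0 : p 0 = a by rewrite /p scale0r addr0.
have p1 : p 1 = b by rewrite /p scale1r.
pose S := `[(0:R), 1] `*` [set y : 'rV[R]_n | enorm (y - x : vec R n) <= 2 * r].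
have inS t y : 0 <= t <= 1 -> enorm (y - x) <= 2 * r -> (t, y) \in S.
  by move=> t01 yx; rewrite inE /S; split => //=; rewrite in_itv.
have [||[t y] yS Fmin] := @compact_EVT_min _ _ F S _ _ (continuous_subspaceT cF).
- by exists (0, a); have := inS 0 a; rewrite inE; apply; lra.
- by apply: compact_setX; [exact: segment_compact|exact: compact_enorm_ball].
have [t01 yx] : 0 <= t <= 1 /\ enorm (y - x) <= 2 * r.
  by move: yS; rewrite inE => -[] /=; rewrite in_itv.
have lipf z1 z2 : enorm (z1 - x) < 3 * r -> enorm (z2 - x) < 3 * r ->
    dot v (g z1) - dot v (g z2) <= K * enorm (z1 - z2).
  move=> h1 h2; rewrite -dotNr -dotDr; apply: le_trans (dot_le_enorm _ _) _.
  by rewrite /K (mulrC L) -mulrA ler_wpM2l ?enorm_ge0 // lip.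
have y3 : enorm (y - x) < 3 * r by lra.
have ptr := pr t t01.
set s := enorm (y - p t).
have s0 : 0 <= s := enorm_ge0 _.
(* Comparison with [(t, p t)] gives [k/2 s^2 <= K s], impossible for [s >= r] since [2 K < k r]. *)
have sr : s < r.
  have := Fmin (t, p t) (inS _ _ t01 _); rewrite /F /= subrr dot0l => H.
  have {}H := H ltac:(lra).
  have := lipf (p t) y ltac:(lra) y3; rewrite enorm_distC -/s => H2.
  move: H; rewrite -sqr_enorm -/s => H.
  have [//|rs] := ltP s r.
  have : k * s ^+ 2 <= 2 * K * s by lra.
  have : 2 * K * s < k * r * s by rewrite ltr_pM2r //; lra.
  have : k * r * s <= k * s ^+ 2 by rewrite expr2 -mulrA ler_pM2l // ler_wpM2r.
  lra.
(* At [t = 0], comparison with [(1, b)] would give [gap + k/2 s^2 <= K s], but [k/2 s^2 - K s] is at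
   least [- K^2 / (2 k)], which exceeds [- gap]. *)
have tgt0 : 0 < t.
  rewrite lt_def; have /andP[-> _] := t01; rewrite andbT; apply/eqP => t0.
  have := Fmin (1, b) (inS _ _ _ _); rewrite ler01 lexx => /(_ isT ltac:(lra)).
  rewrite /F /= t0 p0 p1 subrr dot0l -sqr_enorm.
  have -> : y - a = y - p t by rewrite t0 p0.
  rewrite -/s => H.
  have := lipf a y ltac:(lra) y3.
  have -> : enorm (a - y) = s by rewrite enorm_distC /s t0 p0.
  have DE : dot v (g b) - dot v (g a) = D by rewrite -dotNr -dotDr dotC.
  rewrite /gap in kgap gap0 *.
  have := sqr_ge0 (k * s - K).
  nra.
pose xi := - k *: (y - p t).
(* Comparison with [(t - h, y)]: since [t > 0], moving backwards stays in [[0, 1]], even from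
   [t = 1]. *)
have xi_le (h : R) : 0 < h -> h <= t -> dot xi v <= m + k / 2 * h * Q.
  move=> h0 ht.
  have := Fmin (t - h, y) (inS _ _ _ yx).
  have -> : 0 <= t - h <= 1 by lra.
  move=> /(_ isT); rewrite /F /=.
  have -> : y - p (t - h) = (y - p t) + h *: v.
    by apply/rowP => i; rewrite !mxE; ring.
  rewrite /xi dotZl; move: (y - p t) => w.
  rewrite !dotDl !dotDr !dotZl !dotZr (dotC v w) -/Q => H.
  rewrite -(ler_pM2l h0); lra.
have nrm : regular_normal (graph g) (y, g y) (xi, - v).
  (* With [t] frozen, [y] minimises in the second variable; the radius [r - s] keeps competitors
     within [2 * r] of [x]. *)
  apply: (@prox_regular_normal g v (p t) y k (r - s)) => //.
    by rewrite subr_gt0.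
  move=> z zy; have := Fmin (t, z) (inS _ _ t01 _); rewrite /F /=.
  have := enorm_triangleB y z x; have := enorm_triangleB (p t) y x.
  rewrite -/s => h1 h2 /(_ ltac:(lra)); lra.
have := pos y xi v y3 nrm; rewrite -/Q.
have kQ : 0 < k * Q + 1 by have := mulr_ge0 (ltW k0) Q0; lra.
(* This [h] makes [k / 2 * h * Q < gap], so [<xi, v> < m + gap = kappa * Q], against [pos]. *)
pose h := Num.min t (gap / (k * Q + 1)).
have h0 : 0 < h by rewrite lt_min tgt0 divr_gt0.
have hg : h * (k * Q + 1) <= gap.
  by rewrite -ler_pdivlMr // ge_min lexx orbT.
have := xi_le h h0; rewrite ge_min lexx => /(_ isT).
nra.
Qed.

End StrongMonotonicity.

(** * Local estimates and decrease per Newton step *)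

Section Newton.
Variables (R : realType) (n : nat).
Implicit Types (a d u v x y z : vec R n) (g : vec R n -> vec R n).
Implicit Types (phi : vec R n -> R).

(** Collects on one ball all constants used later; the two [hess2] bounds pass to the limit from
    regular normals at nearby points. *)
Lemma posdef_hess2_local g x : locally_lipschitz g -> posdef_hess2 g x ->
  exists kappa L r : R, [/\ 0 < kappa, 0 < L, 0 < r &
  [/\ forall y z, enorm (y - x) < r -> enorm (z - x) < r ->
        enorm (g y - g z) <= L * enorm (y - z),
      forall y u z, enorm (y - x) < r -> hess2 g y u z ->
        kappa * dot u u <= dot z u,
      forall y u z, enorm (y - x) < r -> hess2 g y u z ->
        enorm z <= L * enorm u &
      forall a v, enorm (a - x) < r -> enorm (a + v - x) < r ->
        kappa * dot v v <= dot (g (a + v) - g a) v]].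
Proof.
move=> lg pd; have cg := locally_lipschitz_continuous lg.
have [kappa [r1 [kappa0 r10 pos]]] := posdef_hess2_uniform lg pd.
have [L0 [r2 r20 lip0]] := lg x.
pose L := `|L0| + 1; have Lgt0 : 0 < L by rewrite ltr_wpDl.
(* The factor 3 matches the radii in [strong_monotone]. *)
pose r := Num.min r1 r2 / 3.
have r0 : 0 < r by rewrite divr_gt0 // lt_min r10.
have rr1 : 3 * r <= r1.
  have : Num.min r1 r2 <= r1 by rewrite ge_min lexx.
  by rewrite /r; lra.
have rr2 : 3 * r <= r2.
  have : Num.min r1 r2 <= r2 by rewrite ge_min lexx orbT.
  by rewrite /r; lra.
have lip y z : enorm (y - x) < 3 * r -> enorm (z - x) < 3 * r ->
    enorm (g y - g z) <= L * enorm (y - z).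
  move=> yr zr; have := lip0 y z (lt_le_trans yr rr2) (lt_le_trans zr rr2).
  move=> /le_trans; apply; rewrite ler_wpM2r ?enorm_ge0 // /L.
  by have := ler_norm L0; lra.
have near_ball y (c : nat -> vec R n) : enorm (y - x) < r ->
    c k @[k --> \oo] --> y -> \forall k \near \oo, enorm (c k - x) < r.
  move=> yr /cvg_enormP /(_ (r - enorm (y - x))) [|N hN].
    by rewrite subr_gt0.
  exists N => // k /= /hN cky.
  by apply: le_lt_trans (enorm_triangleB y _ _) _; lra.
exists kappa, L, r; split=> //; split.
- by move=> y z yr zr; apply: lip; lra.
- move=> y u z yr /(hess2P _ _ _ cg) [c [xi [v [cy xiz vu nrm]]]].
  have lhs : kappa * dot (v k) (v k) @[k --> \oo] --> kappa * dot u u.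
    by apply: cvgM; [exact: cvg_cst|exact: cvg_dot].
  apply: (ler_cvg_to lhs (cvg_dot _ xiz vu)).
  have [N _ hN] := near_ball _ _ yr cy; exists N => // k /= /hN ck.
  by apply: pos (nrm k); lra.
- move=> y u z yr /(hess2P _ _ _ cg) [c [xi [v [cy xiz vu nrm]]]].
  rewrite -(@ler_pXn2r _ 2) ?nnegrE ?mulr_ge0 ?enorm_ge0 ?(ltW Lgt0) //.
  rewrite exprMn !sqr_enorm.
  have rhs : L ^+ 2 * dot (v k) (v k) @[k --> \oo] --> L ^+ 2 * dot u u.
    by apply: cvgM; [exact: cvg_cst|exact: cvg_dot].
  apply: (ler_cvg_to (cvg_dot _ xiz xiz) rhs).
  have [N _ hN] := near_ball _ _ yr cy; exists N => // k /= /hN ck.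
  rewrite -!sqr_enorm -exprMn.
  rewrite ler_pXn2r ?nnegrE ?mulr_ge0 ?enorm_ge0 ?(ltW Lgt0) //.
  apply: (@regular_normal_graph_le _ _ g (c k) _ _ _ r) => //; first exact: ltW.
  move=> w wr; have := enorm_triangleB (c k) w x => tri.
  by apply: lip; lra.
- apply: (@strong_monotone _ _ g x kappa L r) => //; first exact: ltW.
  by move=> c xi v cr; apply: pos; lra.
Qed.

(** By the mean value theorem the remainder is [<g (a + t v) - g a, v>]: monotonicity makes it
    nonnegative and the Lipschitz bound caps it. *)
Lemma first_order_bounds phi g x a v (kappa L r : R) : is_gradient phi g ->
  0 <= kappa -> 0 <= L ->
  (forall y z, enorm (y - x) < r -> enorm (z - x) < r ->
     enorm (g y - g z) <= L * enorm (y - z)) ->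
  (forall b w, enorm (b - x) < r -> enorm (b + w - x) < r ->
     kappa * dot w w <= dot (g (b + w) - g b) w) ->
  enorm (a - x) < r -> enorm (a + v - x) < r ->
  0 <= phi (a + v) - phi a - dot (g a) v <= L * dot v v.
Proof.
move=> dphi kappa0 L0 lip mon ar avr.
have [t t01 ->] := gradient_MVT a v dphi.
have tr := enorm_segment_lt t01 ar avr.
rewrite -dotNl -dotDl; have := mon a (t *: v) ar tr.
have := lip _ _ tr ar.
have -> : a + t *: v - a = t *: v by rewrite addrAC subrr add0r.
have /andP[t0 t1] := t01.
rewrite enormZ ger0_norm // => up lo.
have cs := dot_le_enorm (g (a + t *: v) - g a) v.
have v0 := enorm_ge0 v; move: lo cs; rewrite !dotZr dotZl.
set D := dot (g (a + t *: v) - g a) v; rewrite -!sqr_enorm => lo cs; apply/andP; split.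
  (* Monotonicity is applied to [t *: v] and then divided by [t]; for [t = 0] the remainder
     vanishes. *)
  have [t00|tN0] := eqVneq t 0.
    by rewrite /D t00 scale0r addr0 subrr dot0l.
  have tpos : 0 < t by rewrite lt_def tN0.
  rewrite -(pmulr_rge0 _ tpos); apply: le_trans lo.
  by rewrite !mulr_ge0 ?sqr_ge0.
apply: le_trans cs _; apply: le_trans (ler_wpM2r v0 up) _.
rewrite -!mulrA -expr2 ler_wpM2l // -[leRHS]mul1r.
by rewrite ler_wpM2r ?sqr_ge0.
Qed.

(** The two conclusions feed each other by induction: positive-definiteness on the level set gives
    [<g x, d> <= 0], and the resulting descent keeps the next iterate in the level set. *)
Lemma GDNA_nonincreasing phi g (sigma beta : R) x0 xs :
  (forall x, phi x <= phi x0 -> posdef_hess2 g x) -> 0 < sigma -> 0 < beta ->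
  GDNA_sequence phi g sigma beta x0 xs ->
  forall k, phi (xs k) <= phi x0 /\ phi (xs k.+1) <= phi (xs k).
Proof.
move=> pd sigma0 beta0 [xs0 step].
have desc k : phi (xs k) <= phi x0 -> phi (xs k.+1) <= phi (xs k).
  move=> xk; have [_ [d [hd [m [arm [_ ->]]]]]] := step k.
  apply: le_trans arm _; rewrite gerDl.
  have [->|d0] := eqVneq d 0; first by rewrite dot0r mulr0.
  have := pd _ xk d _ d0 hd; rewrite dotNl oppr_gt0 => /ltW gd.
  by rewrite mulr_ge0_le0 // mulr_ge0 // ltW // exprn_gt0.
suff le0 k : phi (xs k) <= phi x0 by move=> k; split=> //; exact: desc.
elim: k => [|k IH]; first by rewrite xs0.
exact: le_trans (desc k IH) IH.
Qed.

(** If [m > 0], the previous trial [beta ^+ m.-1] was rejected and hence exceeds [T]. *)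
Lemma backtracking_lower_bound phi g (sigma beta T : R) x d m :
  0 < beta < 1 -> 0 < T <= 1 ->
  (forall t, 0 < t <= T -> armijo phi g sigma x d t) ->
  (forall j, (j < m)%N -> ~ armijo phi g sigma x d (beta ^+ j)) ->
  beta * T <= beta ^+ m.
Proof.
move=> /andP[b0 b1] /andP[T0 T1] arm; case: m => [_|m /(_ m (ltnSn m)) narm].
  by rewrite expr0; nra.
rewrite exprS ler_pM2l // leNgt; apply/negP => lt; apply: narm; apply: arm.
by rewrite exprn_gt0 // ltW.
Qed.

(** The Newton inclusion gives [kappa |d|^2 <= - <g x, d>] and [|g x| <= L |d|], so the Armijo
    decrease is at least a multiple of [|g x|^2] once the step length is bounded below. *)
Lemma newton_step_decrease phi g xbar (sigma beta kappa L r : R) :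
  0 < sigma < 1 -> 0 < beta < 1 -> 0 < kappa -> 0 < L -> 0 < r ->
  is_gradient phi g ->
  (forall y z, enorm (y - xbar) < r -> enorm (z - xbar) < r ->
     enorm (g y - g z) <= L * enorm (y - z)) ->
  (forall y u z, enorm (y - xbar) < r -> hess2 g y u z ->
     kappa * dot u u <= dot z u) ->
  (forall y u z, enorm (y - xbar) < r -> hess2 g y u z ->
     enorm z <= L * enorm u) ->
  (forall a v, enorm (a - xbar) < r -> enorm (a + v - xbar) < r ->
     kappa * dot v v <= dot (g (a + v) - g a) v) ->
  exists2 c : R, 0 < c & forall x d m, enorm (x - xbar) < r / 2 ->
    hess2 g x d (- g x) -> armijo phi g sigma x d (beta ^+ m) ->
    (forall j, (j < m)%N -> ~ armijo phi g sigma x d (beta ^+ j)) ->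
    c * dot (g x) (g x) <= phi x - phi (x + beta ^+ m *: d).
Proof.
move=> /andP[sigma0 sigma1] beta01 kappa0 L0 r0 dphi lip pos bnd mon.
have /andP[beta0 beta1] := beta01.
(* [B] bounds [enorm d], from [kappa |d| <= |g x| <= |g xbar| + L r]. *)
pose B := (enorm (g xbar) + L * r) / kappa + 1.
have B0 : 0 < B.
  rewrite /B ltr_wpDl // divr_ge0 ?(ltW kappa0) //.
  by rewrite addr_ge0 ?enorm_ge0 // mulr_ge0 ?ltW.
(* [T <= r / 2 / B] keeps [x + t *: d] in the ball of radius [r]; [T * L <= (1 - sigma) * kappa]
   lets the first-order bound imply the Armijo test. *)
pose T := Num.min 1 (Num.min (r / 2 / B) ((1 - sigma) * kappa / L)).
have T0 : 0 < T.
  rewrite !lt_min ltr01 /= !divr_gt0 // mulr_gt0 //; lra.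
have T1 : T <= 1 by rewrite ge_min lexx.
have TB : T * B <= r / 2 by rewrite -ler_pdivlMr // !ge_min lexx !orbT.
have TL : T * L <= (1 - sigma) * kappa.
  by rewrite -ler_pdivlMr // !ge_min lexx !orbT.
exists (sigma * beta * T * kappa / L ^+ 2).
  by rewrite divr_gt0 ?exprn_gt0 // !mulr_gt0.
move=> x d m xr2 hd arm narm; have xr : enorm (x - xbar) < r by lra.
have curv := pos _ _ _ xr hd; have gLd := bnd _ _ _ xr hd.
move: curv gLd; rewrite dotNl enormN => curv gLd.
have d0 := enorm_ge0 d; have g0 := enorm_ge0 (g x).
have dB : enorm d < B.
  have : kappa * enorm d <= enorm (g x).
    have [->|dN0] := eqVneq d 0; first by rewrite enorm0 mulr0.
    have dgt0 : 0 < enorm d by rewrite enorm_gt0.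
    rewrite -(ler_pM2r dgt0) -mulrA -expr2 sqr_enorm; apply: le_trans curv _.
    by rewrite -dotNl -(enormN (g x)); exact: dot_le_enorm.
  have : enorm (g x) <= enorm (g xbar) + L * r.
    have := enorm_triangle (g x - g xbar) (g xbar); rewrite subrK.
    have := lip x xbar xr; rewrite subrr enorm0 => /(_ r0).
    have := ler_wpM2l (ltW L0) (ltW xr); lra.
  move=> h1 h2; have : enorm d <= (enorm (g xbar) + L * r) / kappa.
    by rewrite ler_pdivlMr // mulrC (le_trans h2).
  by rewrite /B; lra.
have armT t : 0 < t <= T -> armijo phi g sigma x d t.
  move=> /andP[t0 tT]; rewrite /armijo.
  have tdr : enorm (x + t *: d - xbar) < r.
    rewrite addrAC; apply: le_lt_trans (enorm_triangle _ _) _.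
    rewrite enormZ gtr0_norm //.
    have : t * enorm d <= T * B by rewrite ler_pM ?(ltW t0) ?(ltW dB).
    lra.
  have := first_order_bounds dphi (ltW kappa0) (ltW L0) lip mon xr tdr.
  rewrite !(dotZl, dotZr) => /andP[_ up].
  have tL : t * L <= (1 - sigma) * kappa.
    by apply: le_trans TL; rewrite ler_pM2r.
  have dd0 := dot_ge0 d.
  have h1 := ler_wpM2r dd0 tL.
  have s1 : 0 <= 1 - sigma by lra.
  have h2 := ler_wpM2l s1 curv.
  have h3 : t * (t * L * dot d d) <= t * ((1 - sigma) * - dot (g x) d).
    by rewrite ler_pM2l //; lra.
  lra.
have T01 : 0 < T <= 1 by rewrite T0.
have tau := backtracking_lower_bound beta01 T01 armT narm.
have gd0 : 0 <= - dot (g x) d.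
  by apply: le_trans curv; rewrite mulr_ge0 ?dot_ge0 ?ltW.
have h1 : beta * T * (kappa * dot d d) <= beta ^+ m * (- dot (g x) d).
  by apply: ler_pM => //; rewrite mulr_ge0 ?dot_ge0 // ltW.
have h2 := ler_wpM2l (ltW sigma0) h1.
have h3 : dot (g x) (g x) <= L ^+ 2 * dot d d.
  rewrite -!sqr_enorm -exprMn ler_pXn2r ?nnegrE ?mulr_ge0 //; exact: ltW.
have h4 : sigma * beta * T * kappa / L ^+ 2 * dot (g x) (g x) <=
    sigma * (beta * T * (kappa * dot d d)).
  rewrite mulrAC ler_pdivrMr ?exprn_gt0 //.
  have P0 : 0 <= sigma * beta * T * kappa by rewrite !mulr_ge0 // ltW.
  have := ler_wpM2l P0 h3; lra.
move: arm; rewrite /armijo; lra.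
Qed.

Lemma linear_rate_geometric (e : nat -> R) (mu : R) N : 0 < mu ->
  (forall k, 0 <= e k) ->
  (forall k, (N <= k)%N -> e k.+1 <= mu * e k) ->
  forall k, (N <= k)%N -> e k <= e N / mu ^+ N * mu ^+ k.
Proof.
move=> mu0 e0 rate k /subnKC <-; elim: (k - N)%N => [|j IH].
  by rewrite addn0 divfK // expf_neq0 // gt_eqF.
rewrite addnS exprS mulrCA; apply: le_trans (rate _ (leq_addr _ _)) _.
by rewrite ler_pM2l.
Qed.

End Newton.

(** * Linear convergence rates *)

Theorem theorem4p2 (R : realType) (n : nat)
  (phi : vec R n -> R) (g : vec R n -> vec R n)
  (sigma beta : R) (x0 : vec R n) (xs : nat -> vec R n) (xbar : vec R n) :
  C11 phi g ->
  (forall x : vec R n, phi x <= phi x0 -> posdef_hess2 g x) ->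
  0 < sigma -> sigma < 1 / 2 -> 0 < beta -> beta < 1 ->
  GDNA_sequence phi g sigma beta x0 xs ->
  (forall eps : R, 0 < eps -> exists N : nat, forall k : nat, (N <= k)%N ->
     enorm (xs k - xbar) < eps) ->
  (forall k : nat, xs k != xbar) ->
  (exists mu : R, 0 < mu /\ mu < 1 /\
     exists k0 : nat, forall k : nat, (k0 <= k)%N ->
       phi (xs k.+1) - phi xbar <= mu * (phi (xs k) - phi xbar)) /\
  (exists c lambda : R, 0 < c /\ 0 < lambda /\ lambda < 1 /\
     exists k0 : nat, forall k : nat, (k0 <= k)%N ->
       enorm (xs k - xbar) <= c * lambda ^+ k /\
       enorm (g (xs k)) <= c * lambda ^+ k).
Proof.
move=> [dphi lg] pd sigma0 sigma2 beta0 beta1 gdna xs_lim _.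
have xs_cvg : xs k @[k --> \oo] --> xbar by exact/cvg_enormP.
have desc := GDNA_nonincreasing pd sigma0 beta0 gdna.
have phi_cvg : phi (xs k) @[k --> \oo] --> phi xbar.
  exact: (cvg_comp _ _ xs_cvg (gradient_continuous dphi (x:=xbar))).
have phi_ge k : phi xbar <= phi (xs k).
  apply: (cvgr_to_le phi_cvg); exists k => // j /= /subnKC <-.
  elim: (j - k)%N => [|i IH]; first by rewrite addn0.
  by rewrite addnS; apply: le_trans IH; have [] := desc (k + i)%N.
have pdbar : posdef_hess2 g xbar.
  by apply: pd; apply: le_trans (phi_ge 0%N) _; have [] := desc 0%N.
have [kappa [L [r [kappa0 L0 r0 [lip pos bnd mon]]]]] := posdef_hess2_local lg pdbar.
have sigma01 : 0 < sigma < 1 by lra.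
have beta01 : 0 < beta < 1 by rewrite beta0.
have [c c0 dec] :=
  newton_step_decrease sigma01 beta01 kappa0 L0 r0 dphi lip pos bnd mon.
have r20 : 0 < r / 2 by lra.
have [N hN] := xs_lim _ r20.
have {}dec k : (N <= k)%N ->
    c * dot (g (xs k)) (g (xs k)) <= phi (xs k) - phi (xs k.+1).
  move=> /hN kr; have [_ [d [hd [m [arm [narm ->]]]]]] := gdna.2 k.
  exact: dec.
have decbar k : (N <= k)%N ->
    c * dot (g (xs k)) (g (xs k)) <= phi (xs k) - phi xbar.
  by move=> /dec; have := phi_ge k.+1; lra.
(* In the limit, [decbar] forces [xbar] to be stationary. *)
have gbar : g xbar = 0.
  have gcvg : g (xs k) @[k --> \oo] --> g xbar.
    exact: (cvg_comp _ _ xs_cvg (locally_lipschitz_continuous lg (x:=xbar))).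
  have lhs : c * dot (g (xs k)) (g (xs k)) @[k --> \oo] -->
      c * dot (g xbar) (g xbar).
    by apply: cvgM; [exact: cvg_cst|exact: cvg_dot].
  have rhs : phi (xs k) - phi xbar @[k --> \oo] --> phi xbar - phi xbar.
    by apply: cvgB => //; exact: cvg_cst.
  have : c * dot (g xbar) (g xbar) <= phi xbar - phi xbar.
    by apply: (ler_cvg_to lhs rhs); exists N => // k /= /decbar.
  rewrite subrr pmulr_rle0 // -sqr_enorm => g0.
  by apply/eqP; rewrite -enorm_eq0 -sqrf_eq0 eq_le g0 sqr_ge0.
(* Error bound: strong monotonicity between [xbar] and [xs k], where [g xbar = 0]. *)
have xg k : (N <= k)%N -> kappa * enorm (xs k - xbar) <= enorm (g (xs k)).
  move=> /hN kr; set v := xs k - xbar.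
  have [->|vN0] := eqVneq v 0; first by rewrite enorm0 mulr0 enorm_ge0.
  have v0 : 0 < enorm v by rewrite enorm_gt0.
  have xv : xbar + v = xs k by rewrite /v addrC subrK.
  have := mon xbar v; rewrite subrr enorm0 xv gbar subr0 => /(_ r0 ltac:(lra)).
  move=> h; rewrite -(ler_pM2r v0) -mulrA -expr2 sqr_enorm.
  exact: le_trans h (dot_le_enorm _ _).
(* Polyak-Lojasiewicz inequality: the lower first-order bound gives [phi (xs k) - phi xbar <= <g (xs
   k), xs k - xbar>], then Cauchy-Schwarz and [xg] apply. *)
have PL k : (N <= k)%N ->
    kappa * (phi (xs k) - phi xbar) <= dot (g (xs k)) (g (xs k)).
  move=> Nk; have kr := hN k Nk; have xgk := xg k Nk.
  have xv : xs k + (xbar - xs k) = xbar by rewrite addrC subrK.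
  have := @first_order_bounds _ _ phi g xbar (xs k) (xbar - xs k) kappa L r
    dphi (ltW kappa0) (ltW L0) lip mon.
  rewrite xv subrr enorm0 => /(_ ltac:(lra) r0) /andP[lo _].
  have := dot_le_enorm (g (xs k)) (xs k - xbar).
  have -> : dot (g (xs k)) (xs k - xbar) = - dot (g (xs k)) (xbar - xs k).
    by rewrite -dotNr opprB.
  have := ler_wpM2l (enorm_ge0 (g (xs k))) xgk; rewrite -expr2 sqr_enorm => h1 h2.
  apply: le_trans h1; rewrite mulrCA ler_pM2l //; lra.
(* [1 - c * kappa] may fail to be positive; the maximum with [1 / 2] secures [0 < mu]. *)
pose mu := Num.max (1 / 2) (1 - c * kappa).
have mu0 : 0 < mu by rewrite lt_max; apply/orP; left; lra.
have mu1 : mu < 1.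
  by rewrite gt_max; have := mulr_gt0 c0 kappa0; lra.
have rate k : (N <= k)%N ->
    phi (xs k.+1) - phi xbar <= mu * (phi (xs k) - phi xbar).
  move=> Nk; apply: (@le_trans _ _ ((1 - c * kappa) * (phi (xs k) - phi xbar))).
    have := ler_wpM2l (ltW c0) (PL k Nk); have := dec k Nk; lra.
  by rewrite ler_wpM2r ?subr_ge0 ?phi_ge // le_max lexx orbT.
split; first by exists mu; do 2!split=> //; exists N.
pose E k := phi (xs k) - phi xbar.
have E0 k : 0 <= E k by rewrite subr_ge0.
have geo := linear_rate_geometric mu0 E0 rate.
(* By [decbar] and [geo], [|g (xs k)|^2 <= C mu^k]; taking square roots yields [s] and [lambda]. *)
pose C := E N / mu ^+ N / c.
pose s := Num.sqrt C; pose lambda := Num.sqrt mu.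
have lam0 : 0 < lambda by rewrite sqrtr_gt0.
have gk k : (N <= k)%N -> enorm (g (xs k)) <= s * lambda ^+ k.
  move=> Nk; rewrite -(@ler_pXn2r _ 2) ?nnegrE ?enorm_ge0 //; last first.
    by rewrite mulr_ge0 ?sqrtr_ge0 // exprn_ge0 ?sqrtr_ge0.
  have C0 : 0 <= C by rewrite !divr_ge0 ?exprn_ge0 // ltW.
  rewrite sqr_enorm exprMn (exprAC lambda) !sqr_sqrtr ?(ltW mu0) //.
  rewrite /C mulrAC ler_pdivlMr // mulrC.
  exact: le_trans (decbar k Nk) (geo k Nk).
have s0 : 0 <= s := sqrtr_ge0 _.
(* [s] serves the gradients, [s / kappa] the iterates, and 1 makes the constant positive even if
   [s = 0]. *)
exists (s + s / kappa + 1), lambda.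
have sk0 : 0 <= s / kappa by rewrite divr_ge0 // ltW.
split; first by lra.
split=> //; split.
  by rewrite -[ltRHS]sqrtr1 ltr_sqrt.
exists N => k Nk; have lk : 0 <= lambda ^+ k by rewrite exprn_ge0 // ltW.
split.
  apply: (@le_trans _ _ (s / kappa * lambda ^+ k)).
    by rewrite mulrAC ler_pdivlMr // mulrC; apply: le_trans (xg k Nk) (gk k Nk).
  by rewrite ler_wpM2r //; lra.
apply: le_trans (gk k Nk) _.
by rewrite ler_wpM2r //; lra.
Qed.
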